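(* For every pair of integers $m \geq 3$ and $n \geq 2$, the following hold: (i) if $n\in\{2,3\}$, then $\chi_s(C_m \times P_n)=3$; (ii) if $m=3k$ for some $k\in\mathbb{N}$ and $n\in\{4,5\}$, then $\chi_s(C_m \times P_n)=4$; (iii) if $m$ is not of the form $3k$ with $k\in\mathbb{N}$ and $n\in\{4,5\}$, then $\chi_s(C_m \times P_n)\leq 5$; (iv) in all other cases (that is, if $n\geq 6$), $\chi_s(C_m \times P_n)=5$.
   Context: All graphs are undirected, finite and simple. $C_m$ denotes the cycle on $m$ vertices ($m\geq 3$) and $P_n$ the path on $n$ vertices. A $k$-star coloring of a graph $G$ is a proper vertex coloring of $G$ with colors from $\{1,\dots,k\}$ such that every path on four vertices in $G$ (as a not necessarily induced subgraph) uses at least three distinct colors. The star chromatic number $\chi_s(G)$ is the smallest integer $k$ such that $G$ has a $k$-star coloring. The tensor product $G \times H$ is the graph with vertex set $V(G)\times V(H)$ in which $(u,v)$ and $(u',v')$ are adjacent if and only if $uu'\in E(G)$ and $vv'\in E(H)$. *)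

(* Defs.v *)
From mathcomp Require Import all_boot.

Set Implicit Arguments.
Unset Strict Implicit.
Unset Printing Implicit Defensive.

Record sgraph : Type := SGraph {
  vertex :> finType;
  adj : rel vertex;
  adj_sym : symmetric adj;
  adj_irr : irreflexive adj }.

Section StarColoring.
Variables (G : sgraph) (k : nat).

Definition proper_coloring (f : {ffun G -> 'I_k}) : bool :=
  [forall x : G, forall y : G, adj x y ==> (f x != f y)].

(* A sequence of pairwise distinct vertices, consecutive ones being adjacent:
   a path of G that need not be induced. *)
Definition is_P4 (a b c d : G) : bool :=
  uniq [:: a; b; c; d] && [&& adj a b, adj b c & adj c d].

(* The k colors are the elements of 'I_k, i.e. 0, ..., k-1. *)
Definition star_coloring (f : {ffun G -> 'I_k}) : bool :=
  proper_coloring f &&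
  [forall a : G, forall b : G, forall c : G, forall d : G,
     is_P4 a b c d ==> (3 <= #|[set f a; f b; f c; f d]|)].

Definition star_colorable : bool :=
  [exists f : {ffun G -> 'I_k}, star_coloring f].

End StarColoring.

Lemma star_colorable_card (G : sgraph) : star_colorable G #|G|.
Proof.
apply/existsP; exists [ffun x => enum_rank x]; apply/andP; split.
  apply/forallP => x; apply/forallP => y; apply/implyP => xy.
  rewrite !ffunE (inj_eq enum_rank_inj).
  by apply: contraTneq xy => ->; rewrite adj_irr.
apply/forallP => a; apply/forallP => b; apply/forallP => c; apply/forallP => d.
apply/implyP => /andP [abcd _]; rewrite !ffunE.
have /card_uniqP card3 : uniq (map (@enum_rank G) [:: a; b; c]).
  rewrite (map_inj_uniq enum_rank_inj).
  by move: abcd; rewrite (cat_uniq [:: a; b; c] [:: d]) => /andP [].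
rewrite -[3]/(size (map (@enum_rank G) [:: a; b; c])) -card3.
apply: subset_leq_card; apply/subsetP => x.
by rewrite !inE => /or3P [] ->; rewrite ?orbT.
Qed.

Lemma star_colorable_ex (G : sgraph) : exists k, star_colorable G k.
Proof. by exists #|G|; apply: star_colorable_card. Qed.

Definition star_chromatic_number (G : sgraph) : nat :=
  ex_minn (star_colorable_ex G).

(* [ordS i] is the successor of i modulo m.  The condition [i != j] is implied
   by the rest when m >= 2; it only discards the loop of the case m = 1. *)
Definition cycle_adj (m : nat) : rel 'I_m :=
  [rel i j : 'I_m | (i != j) && ((j == ordS i) || (i == ordS j))].

Lemma cycle_adj_sym m : symmetric (@cycle_adj m).
Proof. by move=> i j; rewrite /cycle_adj /= eq_sym orbC. Qed.

Lemma cycle_adj_irr m : irreflexive (@cycle_adj m).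
Proof. by move=> i; rewrite /cycle_adj /= eqxx. Qed.

Definition cycle_graph (m : nat) : sgraph :=
  SGraph (@cycle_adj_sym m) (@cycle_adj_irr m).

Definition path_adj (n : nat) : rel 'I_n :=
  [rel i j : 'I_n | (j == i.+1 :> nat) || (i == j.+1 :> nat)].

Lemma path_adj_sym n : symmetric (@path_adj n).
Proof. by move=> i j; rewrite /path_adj /= orbC. Qed.

Lemma path_adj_irr n : irreflexive (@path_adj n).
Proof. by move=> i; rewrite /path_adj /= orbb ltn_eqF. Qed.

Definition path_graph (n : nat) : sgraph :=
  SGraph (@path_adj_sym n) (@path_adj_irr n).

Section TensorProduct.
Variables G H : sgraph.

Definition tensor_adj : rel (G * H)%type :=
  [rel p q | adj p.1 q.1 && adj p.2 q.2].

Lemma tensor_adj_sym : symmetric tensor_adj.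
Proof. by move=> p q; rewrite /tensor_adj /= adj_sym (adj_sym p.2). Qed.

Lemma tensor_adj_irr : irreflexive tensor_adj.
Proof. by move=> p; rewrite /tensor_adj /= adj_irr. Qed.

Definition tensor_product : sgraph := SGraph tensor_adj_sym tensor_adj_irr.

End TensorProduct.

(* Main.v *)
Require Import Defs.
From mathcomp Require Import all_boot.
From mathcomp Require Import zify.

Set Implicit Arguments.
Unset Strict Implicit.
Unset Printing Implicit Defensive.

(** A proper coloring is a star coloring when no path a - b - c - d has
    f a = f c and f b = f d ([star_coloringP]).  In C_m x P_n adjacent vertices
    lie in rows of opposite parity, so every such path can be read with b in an
    odd row and c in an even one ([tensor_path_star_map]).

    Upper bounds.  The odd rows are colored by the column, in a way that tells
    columns at distance 2 apart as far as possible; the neighbors b and d of c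
    can then share a color only in few positions, where the colors of the even
    rows exclude f a = f c.
    - Three rows ([colorable3]): row 1 is the only odd row.  Color it by
      g : Z/m -> {0,1,2} with g (i - 1) <> g (i + 1), and give the vertices of
      column i in the outer rows the color missing from g (i - 1), g (i + 1).
      The vertices b and d, both in row 1, never share a color.
    - 3 %| m and five rows ([colorable4]): rows 1 to 3 have the color i mod 3,
      rows 0 and 4 a fourth color.
    - In general ([colorable5]): let g : Z/m -> bool be such that no three
      columns i - 2, i, i + 2 agree.  A vertex (i, j) of an odd row has the
      color (g i, half j), where half j tells rows j and j + 2 apart.  In an
      even row it has a fifth color, except in the twisted columns, where
      g (i - 1) = g (i + 1); there its color is (~~ g (i + 1), half j).  If
      f b = f d, then b and d are in the same row, so the column of c is
      twisted; f a = f c then puts a in the row of c and in a twisted column,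
      so that twisted columns occur on both sides of the column of b, against
      the choice of g.

    Lower bounds.  A star coloring of C_m x P_n lifts along the winding map
    from Z x {0, .., n-1} with diagonal adjacency, which is injective around
    each vertex since m >= 3.  The lift has no alternating path either, so it
    is enough to find, for each number of colors, one finite set of points of
    Z^2 that admits no such coloring ([colorable_lower]): a path of 4 vertices
    for 2 colors, one parity class of the 4 x 4 grid for 3 colors, and a patch
    of 18 points in 6 rows for 4 colors.  An exhaustive search, proved complete
    in [extendable_complete], refutes each of them by computation. *)

(** * Alternating paths *)

Definition star_map (G : sgraph) (T : eqType) (f : G -> T) : Prop :=
  (forall x y, adj x y -> f x <> f y) /\
  (forall a b c d, is_P4 a b c d -> f a = f c -> f b <> f d).

(** In a proper coloring three consecutive vertices of a path fail to have
    three colors only if the outer two agree, so a path on four vertices with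
    two colors alternates them. *)
Lemma star_coloringP (G : sgraph) k (f : {ffun G -> 'I_k}) :
  reflect (star_map f) (star_coloring f).
Proof.
apply: (iffP andP) => -[proper_f rainbow_f]; split.
- by move=> x y xy; apply/eqP/(implyP (forallP (forallP proper_f x) y)).
- move=> a b c d abcd fac fbd.
  have /implyP/(_ abcd) :=
    forallP (forallP (forallP (forallP rainbow_f a) b) c) d.
  rewrite fac fbd leqNgt ltnS; apply/negP; rewrite negbK.
  apply: leq_trans (subset_leq_card _) (card_size [:: f c; f d]).
  by apply/subsetP=> x; rewrite !inE => /orP[/orP[/orP[]|]|] ->; rewrite ?orbT.
- by do 2!apply/forallP=> ?; apply/implyP=> /proper_f/eqP.
- apply/forallP=> a; apply/forallP=> b; apply/forallP=> c; apply/forallP=> d.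
  apply/implyP=> abcd; have := rainbow_f _ _ _ _ abcd.
  case/andP: abcd => _ /and3P[/proper_f/eqP ab /proper_f/eqP bc].
  move=> /proper_f/eqP cd no_alt.
  have [ac | ac] := eqVneq (f a) (f c); last first.
    rewrite -(_ : #|[set f a; f b; f c]| = 3) ?subset_leq_card ?subsetUl //.
    by rewrite -setUA cardsU1 cards2 !inE !negb_or ac ab bc.
  rewrite -(_ : #|[set f b; f c; f d]| = 3).
    apply/subset_leq_card/subsetP=> x.
    by rewrite !inE => /orP[/orP[]|] ->; rewrite ?orbT.
  have /eqP bd := no_alt ac.
  by rewrite -setUA cardsU1 cards2 !inE !negb_or bd bc cd.
Qed.

Lemma star_map_colorable (G : sgraph) (T : finType) (f : G -> T) :
  star_map f -> star_colorable G #|T|.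
Proof.
move=> [proper_f rainbow_f]; apply/existsP; exists [ffun x => enum_rank (f x)].
apply/star_coloringP; split=> [x y xy | a b c d abcd]; rewrite !ffunE.
  by move/enum_rank_inj; apply: proper_f.
by move/enum_rank_inj=> ac /enum_rank_inj; apply: rainbow_f abcd ac.
Qed.

Lemma chi_le (G : sgraph) k :
  star_colorable G k -> star_chromatic_number G <= k.
Proof. by rewrite /star_chromatic_number; case: ex_minnP => c _; apply. Qed.

Lemma chi_colorable (G : sgraph) : star_colorable G (star_chromatic_number G).
Proof. by rewrite /star_chromatic_number; case: ex_minnP. Qed.

(** * Neighbors in cycles, paths and tensor products *)

Lemma val_ordS m (i : 'I_m) : ordS i = (if i.+1 == m then 0 else i.+1) :> nat.
Proof.
rewrite /=; case: eqP => [-> | ne]; first by rewrite modnn.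
by rewrite modn_small //; have := ltn_ord i; lia.
Qed.

Lemma val_ord_pred m (i : 'I_m) :
  ord_pred i = (if i == 0 :> nat then m.-1 else i.-1) :> nat.
Proof.
rewrite /=; have := ltn_ord i; case: eqP => [-> | ne] lt_im.
  by rewrite add0n modn_small //; lia.
have ->: (i + m).-1 = i.-1 + m by lia.
by rewrite modnDr modn_small //; lia.
Qed.

Lemma cycle_adjP m (i j : cycle_graph m) :
  adj i j -> j = ordS i \/ j = ord_pred i.
Proof.
by case/andP=> _ /orP[/eqP | /eqP ->]; [left | right; rewrite ordSK].
Qed.

(** Two distinct neighbors of k in a cycle are its successor and its
    predecessor, in one order or the other. *)
Lemma two_cycle_nbrs m (T : eqType) (g : 'I_m -> T) (k i j : cycle_graph m) :
  adj k i -> adj k j -> i <> j -> g i = g j -> g (ordS k) = g (ord_pred k).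
Proof. by move=> /cycle_adjP[] -> /cycle_adjP[] ->. Qed.

Lemma path_nbrs n (i j k : path_graph n) :
  adj k i -> adj k j -> i = j \/ i = j.+2 :> nat \/ j = i.+2 :> nat.
Proof.
by move=> /orP[]/eqP ki /orP[]/eqP kj;
  [left; apply: val_inj | right | right | left; apply: val_inj] => /=; lia.
Qed.

Lemma tensor_path_eq (G : sgraph) n (x y : tensor_product G (path_graph n)) :
  x.1 = y.1 -> x.2 = y.2 :> nat -> x = y.
Proof. by move=> xy1 xy2; apply: injective_projections (val_inj _). Qed.

Lemma tensor_path_row (G : sgraph) n (x : tensor_product G (path_graph n)) :
  x.2 < n.
Proof. exact: ltn_ord. Qed.

(** A path on four vertices has its second vertex in an odd row, possibly after
    reversal, since adjacent rows have opposite parities. *)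
Lemma tensor_path_star_map (G : sgraph) n (T : eqType)
    (f : tensor_product G (path_graph n) -> T) :
  (forall x y : tensor_product G (path_graph n),
     adj x y -> odd x.2 -> ~~ odd y.2 -> f x <> f y) ->
  (forall a b c d : tensor_product G (path_graph n),
     adj b a -> adj b c -> adj c b -> adj c d -> a <> c -> b <> d ->
     ~~ odd a.2 -> odd b.2 -> ~~ odd c.2 -> odd d.2 ->
     f a = f c -> f b <> f d) ->
  star_map f.
Proof.
move=> proper_f rainbow_f.
have odd_adj (x y : tensor_product G (path_graph n)) :
    adj x y -> odd y.2 = ~~ odd x.2.
  by case/andP=> _ /orP[]/eqP -> /=; rewrite ?negbK.
split=> [x y xy | a b c d /andP[]].
  have [ox | ex] := boolP (odd x.2).
    by apply: proper_f => //; rewrite (odd_adj _ _ xy) ox.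
  by apply/nesym/proper_f; rewrite ?(odd_adj _ _ xy) // adj_sym.
rewrite /= !inE !negb_or => /and3P[/and3P[_ /eqP ac _] /andP[_ /eqP bd] _].
case/and3P=> ab bc cd fac fbd.
have [[ba cb] dc] : (adj b a /\ adj c b) /\ adj d c.
  by split; first split; rewrite adj_sym.
have [ob | eb] := boolP (odd b.2).
  apply: (rainbow_f a b c d) => //.
  - by rewrite (odd_adj _ _ ba) ob.
  - by rewrite (odd_adj _ _ bc) ob.
  - by rewrite (odd_adj _ _ cd) (odd_adj _ _ bc) ob.
apply: (rainbow_f d c b a) => //; try exact: nesym.
- by rewrite (odd_adj _ _ cd) (odd_adj _ _ bc) negbK.
- by rewrite (odd_adj _ _ bc).
- by rewrite (odd_adj _ _ ba).
Qed.

(** * Three colors for at most three rows *)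

(** The third color is 2 (x + y) = - (x + y) in Z/3, as 0 + 1 + 2 = 0. *)
Definition third (x y : 'I_3) : 'I_3 := inord ((2 * (x + y)) %% 3).

Lemma third_neq x y : x <> y -> third x y <> x /\ third x y <> y.
Proof.
case: x y => [[|[|[|x]]] ltx] [[|[|[|y]]] lty] // ne;
  try by case: ne; apply: val_inj.
all: by split=> /(congr1 val); rewrite /third /= inordK.
Qed.

(** The columns carry the pattern 0 0 1 1 0 0 1 1 .., except that the last two
    get the color 2, so that no conflict arises across the seam.  For m = 3 the
    last two columns are themselves at distance 2. *)
Lemma three_colors_step2 m : 2 < m ->
  exists g : 'I_m -> 'I_3, forall i, g (ordS i) <> g (ord_pred i).
Proof.
move=> m_gt2.
pose g i := if m == 3 then i else if m - 2 <= i then 2 else i %% 4 %/ 2.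
have g_lt3 (i : 'I_m) : g i < 3.
  by have := ltn_ord i; rewrite /g; repeat case: ifP => ?; lia.
exists (fun i => Ordinal (g_lt3 i)) => i /(congr1 (@nat_of_ord 3)) eq_g.
have {eq_g}: g (ordS i) = g (ord_pred i) := eq_g.
have := ltn_ord i; rewrite val_ordS val_ord_pred.
by case: eqP; case: eqP; rewrite /g; repeat case: ifP => ?; lia.
Qed.

Lemma colorable3 m n : 2 < m -> n <= 3 ->
  star_colorable (tensor_product (cycle_graph m) (path_graph n)) 3.
Proof.
move=> m_gt2 n_le3; have [g step2] := three_colors_step2 m_gt2.
pose f (p : tensor_product (cycle_graph m) (path_graph n)) :=
  if odd p.2 then g p.1 else third (g (ordS p.1)) (g (ord_pred p.1)).
rewrite -(card_ord 3); apply: (@star_map_colorable _ _ f).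
apply: tensor_path_star_map
  => [x y xy ox ey | a b c d _ _ cb cd _ bd _ ob _ od _].
  rewrite /f ox (negbTE ey).
  move: xy; rewrite adj_sym => /andP[/cycle_adjP yx _].
  by have [] := third_neq (step2 y.1); case: yx => <- ? ?; apply/nesym.
rewrite /f ob od => gbd.
case/andP: cb => cb _; case/andP: cd => cd _.
apply: (step2 c.1); apply: two_cycle_nbrs cb cd _ gbd => e1; apply: bd.
apply: tensor_path_eq => //.
by have := tensor_path_row b; have := tensor_path_row d; lia.
Qed.

(** * Four colors for at most five rows when 3 divides m *)

Lemma three_colors_step12 m : 2 < m -> 3 %| m ->
  exists h : 'I_m -> 'I_3, (forall i, h i <> h (ordS i)) /\
                           (forall i, h (ordS i) <> h (ord_pred i)).
Proof.
move=> m_gt2 m3; exists (fun i : 'I_m => Ordinal (ltn_pmod i (isT : 0 < 3))).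
split=> i /(congr1 (@nat_of_ord 3)) eq_mod; have lt_im := ltn_ord i.
  have: i = ordS i %[mod 3] := eq_mod.
  by rewrite val_ordS; case: eqP; lia.
have: ordS i = ord_pred i %[mod 3] := eq_mod.
by rewrite val_ordS val_ord_pred; do 2![case: eqP]; lia.
Qed.

Lemma between_odds b c d : odd b -> odd d -> b < 5 -> d < 5 -> b <> d ->
  (b == c.+1) || (c == b.+1) -> (d == c.+1) || (c == d.+1) -> c = 2.
Proof. by case: b d => [|[|[|[|[|b]]]]] [|[|[|[|[|d]]]]] // _ _ _ _ _; lia. Qed.

(** If f b = f d, then b and d are in the same column, hence in rows 1 and 3,
    and c is in row 2.  The other neighbors of b are in row 0 or 4, which have
    the fourth color, or in row 2 two columns away from c, where h differs. *)
Lemma colorable4 m n : 2 < m -> 3 %| m -> n <= 5 ->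
  star_colorable (tensor_product (cycle_graph m) (path_graph n)) 4.
Proof.
move=> m_gt2 m3 n_le5.
have [h [step1 step2]] := three_colors_step12 m_gt2 m3.
have adj_h (i j : cycle_graph m) : adj i j -> h i <> h j.
  case/cycle_adjP=> ->; first exact: step1.
  by have /nesym := step1 (ord_pred i); rewrite ord_predK.
have nbrs (k i j : cycle_graph m) : adj k i -> adj k j -> h i = h j -> i = j.
  move=> ki kj hij; apply/eqP/contraT => /eqP ij.
  by case: (step2 k); apply: two_cycle_nbrs ki kj ij hij.
pose f (p : tensor_product (cycle_graph m) (path_graph n)) :=
  if 0 < p.2 < 4 then Some (h p.1) else None.
have row5 (x : tensor_product (cycle_graph m) (path_graph n)) : x.2 < 5.
  exact: leq_trans (tensor_path_row x) n_le5.
have inner (x : tensor_product (cycle_graph m) (path_graph n)) :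
    odd x.2 -> 0 < x.2 < 4.
  by have := row5 x; lia.
have ->: 4 = #|{: option 'I_3}| by rewrite card_option card_ord.
apply: (@star_map_colorable _ _ f).
apply: tensor_path_star_map
  => [x y /andP[xy _] ox _ | a b c d ba bc cb cd ac bd ea ob _ od].
  by rewrite /f inner //; case: ifP => // _ [exy]; case: (adj_h _ _ xy).
rewrite /f (inner b) // (inner d) //.
case/andP: ba => ba1 _; case/andP: bc => bc1 _.
case/andP: cb => cb1 cb2; case/andP: cd => cd1 cd2.
move=> fac [/(nbrs _ _ _ cb1 cd1) bd1].
have bd2 : b.2 <> d.2 :> nat by move=> bd2; apply: bd; apply: tensor_path_eq.
have c2 : c.2 = 2 :> nat.
  exact: between_odds ob od (row5 b) (row5 d) bd2 cb2 cd2.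
move: fac; rewrite c2 [0 < 2 < 4]/=.
case: ifP => // a2 [/(nbrs _ _ _ ba1 bc1) ac1].
apply: ac; apply: tensor_path_eq => //; rewrite c2.
by move: (a.2 : nat) ea a2 => [|[|[|[|[|]]]]].
Qed.

(** * Five colors for any number of rows *)

(** In the pattern 1 1 0 0 1 1 0 0 .., columns at distance 2 differ unless they
    are on different sides of the seam.  Only for m = 3 and i = 1 is the seam
    crossed both from i to i + 2 and from i to i - 2; there i - 2 is column 2,
    whose value differs from that of column 1. *)
Lemma two_colors_step2 m : 2 < m -> exists g : 'I_m -> bool,
  forall i, g i = g (ordS (ordS i)) -> g i <> g (ord_pred (ord_pred i)).
Proof.
move=> m_gt2; pose g k := k %% 4 < 2; exists (fun i => g i) => i; cbv beta.
have g2 k : g k.+2 = ~~ g k by rewrite /g; lia.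
have lt_im := ltn_ord i.
have [lt_i2m | ge_i2m _] := ltnP i.+2 m.
  have ->: ordS (ordS i) = i.+2 :> nat.
    by rewrite !val_ordS; do 2![case: eqP]; lia.
  by rewrite g2; case: (g i).
have [ge2_i | lt_i2] := leqP 2 i.
  have ->: ord_pred (ord_pred i) = i - 2 :> nat.
    by rewrite !val_ord_pred; do 2![case: eqP]; lia.
  by rewrite -{1}(subnK ge2_i) addn2 g2; case: (g _).
have [i1 m3]: i = 1 :> nat /\ m = 3 by lia.
have ->: ord_pred (ord_pred i) = 2 :> nat by rewrite !val_ord_pred i1 m3.
by rewrite i1.
Qed.

Lemma colorable5 m n : 2 < m ->
  star_colorable (tensor_product (cycle_graph m) (path_graph n)) 5.
Proof.
move=> m_gt2; have [g step2] := two_colors_step2 m_gt2.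
pose twist (i : cycle_graph m) := g (ordS i) == g (ord_pred i).
pose half (j : path_graph n) := odd j./2.
have half_nbrs (i j k : path_graph n) :
    adj k i -> adj k j -> half i = half j -> i = j.
  move=> ki kj; case: (path_nbrs ki kj) => // -[]; rewrite /half => -> /=.
    by case: (odd _).
  by case: (odd _).
have twistE k i : adj k i -> twist k -> g i = g (ordS k).
  by move=> /cycle_adjP[] -> // /eqP.
have twist_apart k i j :
    adj k i -> adj k j -> i <> j -> twist i -> twist j -> False.
  have := step2 k; rewrite /twist => kk /cycle_adjP[] -> /cycle_adjP[] -> //;
  by rewrite !ordSK !ord_predK => _ /eqP e1 /eqP e2; apply: kk.
pose f (p : tensor_product (cycle_graph m) (path_graph n)) :=
  if odd p.2 then Some (g p.1, half p.2) else
  if twist p.1 then Some (~~ g (ordS p.1), half p.2) else None.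
have ->: 5 = #|{: option (bool * bool)}|.
  by rewrite card_option card_prod card_bool.
apply: (@star_map_colorable _ _ f).
apply: tensor_path_star_map => [x y xy ox ey | a b c d].
  move: xy; rewrite adj_sym => /andP[yx _].
  rewrite /f ox (negbTE ey); case: ifP => // ty [].
  by rewrite (twistE _ _ yx ty); case: (g _).
case/andP=> ba1 ba2 /andP[bc1 bc2] /andP[cb1 cb2] /andP[cd1 cd2].
move=> ac bd ea ob ec od; rewrite /f ob od (negbTE ea) (negbTE ec).
move=> fac [gbd /(half_nbrs _ _ _ cb2 cd2) bd2].
have tc : twist c.1.
  apply/eqP/(two_cycle_nbrs cb1 cd1) => // bd1.
  by apply: bd; apply: injective_projections.
move: fac; rewrite tc; case: ifP => // ta [_ /(half_nbrs _ _ _ ba2 bc2) ac2].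
apply: (twist_apart _ _ _ ba1 bc1) => // ac1.
by apply: ac; apply: injective_projections.
Qed.

(** * Exhaustive search in the diagonal grid *)

Definition diag_adj (u v : nat * nat) : bool :=
  ((v.1 == u.1.+1) || (u.1 == v.1.+1)) && ((v.2 == u.2.+1) || (u.2 == v.2.+1)).

Lemma diag_adj_sym : symmetric diag_adj.
Proof. by move=> u v; rewrite /diag_adj orbC [X in _ && X]orbC. Qed.

Definition diag_star_map n (T : eqType) (h : nat * nat -> T) : Prop :=
  (forall a b, a.2 < n -> b.2 < n -> diag_adj a b -> h a <> h b) /\
  (forall a b c d, a.2 < n -> b.2 < n -> c.2 < n -> d.2 < n ->
     diag_adj a b -> diag_adj b c -> diag_adj c d ->
     a <> c -> b <> d -> h a = h c -> h b <> h d).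

(** In an alternating path through the new point v, up to reversal, either v is
    an end, as in v - b - c - d, or v is the second vertex, as in d - v - b - c;
    in both cases c shares the color x of v and d shares that of b. *)
Definition clash (s : seq (nat * nat * nat)) (v : nat * nat) (x : nat) : bool :=
  has (fun b => diag_adj v b.1 &&
    ((b.2 == x) ||
     has (fun c => [&& diag_adj b.1 c.1, c.1 != v, c.2 == x &
       has (fun d => [&& d.2 == b.2, d.1 != b.1 &
                         diag_adj c.1 d.1 || diag_adj v d.1]) s]) s)) s.

(** Colors are numbered in the order of their first use: u is the number of
    colors used in s, and a new point has one of them or the color u.  Taking
    colorings up to renaming in this way divides the search by up to k!. *)
Fixpoint extendable k (s : seq (nat * nat * nat)) u (vs : seq (nat * nat)) :=
  if vs is v :: vs' then
    has (fun x => ~~ clash s v x &&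
                  extendable k ((v, x) :: s) (maxn u x.+1) vs')
        (iota 0 (minn k u.+1))
  else true.

Lemma clash_sound n (T : eqType) (h : nat * nat -> T) (pal : seq T) ws v :
  diag_star_map n h -> all (fun w => w.2 < n) (v :: ws) ->
  all (fun w => h w \in pal) (v :: ws) ->
  clash [seq (w, index (h w) pal) | w <- ws] v (index (h v) pal) = false.
Proof.
move=> [proper_h rainbow_h] rows cols.
have inj : {in v :: ws &,
    forall a b, index (h a) pal = index (h b) pal -> h a = h b}.
  by move=> a b /(allP cols) ha /(allP cols) hb; apply: (index_inj (h v)).
have row a : a \in ws -> a.2 < n.
  by move=> aw; apply: (allP rows); rewrite inE aw orbT.
have rowv : v.2 < n by apply: (allP rows); rewrite mem_head.
have memv := mem_head v ws.
have memw a : a \in ws -> a \in v :: ws by rewrite inE orbC => ->.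
apply/hasP=> -[_ /mapP[b bw ->]] /= /andP[vb].
case/orP=> [/eqP bv | /hasP[_ /mapP[c cw ->]]].
  apply: (proper_h v b) => //; first exact: row.
  by apply/esym/inj => //; apply: memw.
case/and4P=> /= bc /eqP cv /eqP /inj hcv /hasP[_ /mapP[d dw ->]].
case/and3P=> /= /eqP /inj hdb /eqP db.
have {}hcv : h c = h v by apply: hcv => //; apply: memw.
have {}hdb : h d = h b by apply: hdb; apply: memw.
case/orP=> [cd | vd].
  by apply: (rainbow_h v b c d) => //; try apply: row => //; exact: nesym.
apply: (rainbow_h d v b c) => //; try apply: row => //; last exact: nesym.
by rewrite diag_adj_sym.
Qed.

(** The palette pal lists the colors of h in the order of their first use on
    ws, so that a color has the number given by its index in pal. *)
Lemma extendable_complete n k (T : finType) (h : nat * nat -> T) pal ws vs :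
  #|T| <= k -> diag_star_map n h -> all (fun w => w.2 < n) (vs ++ ws) ->
  uniq pal -> all (fun w => h w \in pal) ws ->
  extendable k [seq (w, index (h w) pal) | w <- ws] (size pal) vs.
Proof.
move=> Tk star_h; elim: vs ws pal => //= v vs IH ws pal /andP[rowv rows].
move=> uniq_pal cols.
pose pal' := if h v \in pal then pal else rcons pal (h v).
have uniq_pal' : uniq pal'.
  by rewrite /pal'; case: ifPn => // ?; rewrite rcons_uniq uniq_pal andbT.
have cols' : all (fun w => h w \in pal') (v :: ws).
  apply/allP=> w; rewrite inE /pal'.
  case: ifPn => [hv | hv] /predU1P[-> | /(allP cols)] //.
    by rewrite mem_rcons mem_head.
  by rewrite mem_rcons inE orbC => ->.
have idx w : h w \in pal -> index (h w) pal = index (h w) pal'.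
  by rewrite /pal'; case: ifP => // _ hw; rewrite -cats1 index_cat hw.
have -> : [seq (w, index (h w) pal) | w <- ws] =
          [seq (w, index (h w) pal') | w <- ws].
  by apply/eq_in_map => w /(allP cols)/idx ->.
have size_pal' : maxn (size pal) (index (h v) pal').+1 = size pal'.
  rewrite /pal'; case: ifPn => hv; first by apply/maxn_idPl; rewrite index_mem.
  rewrite -cats1 index_cat (negbTE hv) /= eqxx addn0 size_cat addn1.
  by rewrite (maxn_idPr _).
have rows_v : all (fun w => w.2 < n) (v :: ws).
  by move: rows; rewrite all_cat /= rowv => /andP[].
have hv : h v \in pal' by case/andP: cols'.
apply/hasP; exists (index (h v) pal'); last first.
  rewrite (clash_sound star_h) //= size_pal'; apply: (IH (v :: ws)) => //.
  by move: rows rows_v; rewrite !all_cat /= => /andP[-> _] /andP[-> ->].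
rewrite mem_iota leq_min /=; apply/andP; split.
  apply: leq_trans Tk; apply: leq_trans (max_card (mem pal')).
  by rewrite (card_uniqP uniq_pal') index_mem.
have: index (h v) pal' < size pal' by rewrite index_mem.
by move/leq_trans; apply; rewrite /pal'; case: ifP; rewrite ?size_rcons.
Qed.

(** * Lower bounds by winding the grid around the cycle *)

Definition wind m n (m_gt0 : 0 < m) (n_gt0 : 0 < n) (u : nat * nat) :
    tensor_product (cycle_graph m) (path_graph n) :=
  (Ordinal (ltn_pmod u.1 m_gt0), insubd (Ordinal n_gt0) u.2).

Lemma val_wind2 m n (m_gt0 : 0 < m) (n_gt0 : 0 < n) u : u.2 < n ->
  (wind m_gt0 n_gt0 u).2 = u.2 :> nat.
Proof. by move=> un; rewrite val_insubd un. Qed.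

Lemma cycle_adj_succ m (m_gt0 : 0 < m) x : 2 < m ->
  cycle_adj (Ordinal (ltn_pmod x m_gt0)) (Ordinal (ltn_pmod x.+1 m_gt0)).
Proof.
move=> m_gt2; set i := Ordinal _; set j := Ordinal _.
have ->: j = ordS i.
  by apply: val_inj; rewrite /= -addn1 -(addn1 (x %% m)) modnDml.
apply/andP; split; last by rewrite eqxx.
apply/eqP => /(congr1 (@nat_of_ord m)); rewrite val_ordS.
by case: eqP; lia.
Qed.

Lemma wind_adj m n (m_gt0 : 0 < m) (n_gt0 : 0 < n) u v : 2 < m ->
  u.2 < n -> v.2 < n -> diag_adj u v ->
  adj (wind m_gt0 n_gt0 u) (wind m_gt0 n_gt0 v).
Proof.
move=> m_gt2 un vn /andP[uv1 uv2]; apply/andP; split.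
  case/orP: uv1 => /eqP uv1; last rewrite adj_sym;
  by rewrite /wind uv1; apply: cycle_adj_succ.
by move: uv2; rewrite -(val_wind2 m_gt0 n_gt0 un) -(val_wind2 m_gt0 n_gt0 vn).
Qed.

(** Columns at distance 2 remain distinct modulo m >= 3. *)
Lemma wind_local_inj m n (m_gt0 : 0 < m) (n_gt0 : 0 < n) u v w : 2 < m ->
  v.2 < n -> w.2 < n -> diag_adj u v -> diag_adj u w ->
  wind m_gt0 n_gt0 v = wind m_gt0 n_gt0 w -> v = w.
Proof.
move=> m_gt2 vn wn /andP[uv _] /andP[uw _] eq_vw.
have eq2 : v.2 = w.2 by rewrite -(val_wind2 m_gt0 n_gt0 vn) eq_vw val_wind2.
have mod2 x : x != x.+2 %[mod m].
  by rewrite -addn2 -{1}(addn0 x) eqn_modDl mod0n modn_small.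
have /(congr1 (@nat_of_ord m)) /= eq1 := congr1 fst eq_vw.
case: v w eq2 uv uw eq1 {vn wn eq_vw} => [v1 v2] [w1 w2] /= -> uv uw eq1.
have [-> // | ne] := eqVneq v1 w1; exfalso.
have [e | e] : v1 = w1.+2 \/ w1 = v1.+2 by lia.
  by have := mod2 w1; rewrite -e eq1 eqxx.
by have := mod2 v1; rewrite -e eq1 eqxx.
Qed.

(** The image of an alternating path is again a path on four vertices: its
    ends cannot coincide, even for m = 3, because their rows have opposite
    parities. *)
Lemma colorable_lower m n k k' vs : 2 < m -> 0 < n ->
  all (fun v => v.2 < n) vs -> ~~ extendable k [::] 0 vs ->
  star_colorable (tensor_product (cycle_graph m) (path_graph n)) k' -> k < k'.
Proof.
move=> m_gt2 n_gt0 rows + /existsP[f /star_coloringP[proper_f rainbow_f]].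
have m_gt0 : 0 < m by lia.
apply: contraR; rewrite -leqNgt => le_k'k.
pose h u := f (wind m_gt0 n_gt0 u).
apply: (@extendable_complete n _ _ h [::] [::]); rewrite ?card_ord ?cats0 //.
split=> [a b an bn ab | a b c d an bn cn dn ab bc cd ac bd].
  exact/proper_f/wind_adj.
apply/rainbow_f/andP; split; last by rewrite !wind_adj.
have inj := @wind_local_inj m n m_gt0 n_gt0.
have [ba cb] : diag_adj b a /\ diag_adj c b.
  by split; rewrite diag_adj_sym.
have adj_neq u v : u.2 < n -> v.2 < n -> diag_adj u v ->
    wind m_gt0 n_gt0 u != wind m_gt0 n_gt0 v.
  move=> un vn uv; apply/eqP=> e.
  by have := wind_adj m_gt0 n_gt0 m_gt2 un vn uv; rewrite e adj_irr.
have ad : wind m_gt0 n_gt0 a != wind m_gt0 n_gt0 d.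
  apply/eqP=> e.
  have : a.2 = d.2 by rewrite -(val_wind2 m_gt0 n_gt0 an) e val_wind2.
  by move: ab bc cd => /andP[_ +] /andP[_ +] /andP[_ +]; lia.
rewrite /= !inE !negb_or (adj_neq a b) // (adj_neq b c) // (adj_neq c d) // ad.
rewrite !andbT /=; apply/andP; split; apply/eqP.
  by move/(inj _ _ _ m_gt2 an cn ba bc).
by move/(inj _ _ _ m_gt2 bn dn cb cd).
Qed.

Definition path4 : seq (nat * nat) := [:: (0, 0); (1, 1); (2, 0); (3, 1)].

Definition even_grid4 : seq (nat * nat) :=
  [seq v <- [seq (x, y) | x <- iota 0 4, y <- iota 0 4] | ~~ odd (v.1 + v.2)].

(** The order of the points matters to the search: it starts in the middle of
    the patch and keeps the colored part connected, so that clashes appear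
    early. *)
Definition patch : seq (nat * nat) :=
  [:: (2, 2); (1, 3); (2, 4); (3, 3); (4, 2); (3, 1); (4, 4); (5, 3); (3, 5);
      (5, 1); (4, 0); (6, 2); (5, 5); (6, 4); (7, 3); (1, 1); (0, 2); (0, 4)].

(* Lazy conversion prunes the search; call-by-value would evaluate both
   arguments of each && and explore every branch to the end. *)
Lemma path4_not_2colorable : ~~ extendable 2 [::] 0 path4.
Proof. by []. Qed.

Lemma even_grid4_not_3colorable : ~~ extendable 3 [::] 0 even_grid4.
Proof. by []. Qed.

Lemma patch_not_4colorable : ~~ extendable 4 [::] 0 patch.
Proof. by []. Qed.

Theorem theorem4 (m n : nat) (hm : 3 <= m) (hn : 2 <= n) :
  let chi := star_chromatic_number
               (tensor_product (cycle_graph m) (path_graph n)) in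
  [/\ (n = 2 \/ n = 3) -> chi = 3,
      (exists k : nat, m = 3 * k) -> (n = 4 \/ n = 5) -> chi = 4,
      ~ (exists k : nat, m = 3 * k) -> (n = 4 \/ n = 5) -> chi <= 5
    & 6 <= n -> chi = 5].
Proof.
have n_gt0 : 0 < n by lia.
have lower := colorable_lower hm n_gt0 _ _ (chi_colorable _).
have rows_le j vs : all (fun v : nat * nat => v.2 < j) vs -> j <= n ->
    all (fun v => v.2 < n) vs.
  by move=> rows le_jn; apply: sub_all rows => v; move/leq_trans; apply.
split=> [n23 | [k m3k] n45 | _ _ | n6].
- apply/eqP; rewrite eqn_leq chi_le; last by apply: colorable3 => //; lia.
  by apply: lower path4_not_2colorable; apply: rows_le hn.
- apply/eqP; rewrite eqn_leq chi_le; last first.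
    by apply: colorable4 => //; [rewrite m3k dvdn_mulr | lia].
  by apply: lower even_grid4_not_3colorable; apply: (@rows_le 4) => //; lia.
- exact/chi_le/colorable5.
- apply/eqP; rewrite eqn_leq chi_le; last exact: colorable5.
  by apply: lower patch_not_4colorable; apply: rows_le n6.
Qed.
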